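(* Let $G_\theta:\mathbb{R}^{N_z}\to\mathbb{R}^{N_u}$ be a generator (a neural network with continuous activation functions, hence a continuous and in particular measurable map). Let $Z$ be a latent variable distributed according to a probability distribution $P_z^g$ on $\mathbb{R}^{N_z}$ with PDF $\rho_z^g$, and let $U=G_\theta(Z)$, so that $U$ is distributed according to the push-forward distribution $P_u^g=G_{\theta\#}P_z^g$ on $\mathbb{R}^{N_u}$, with PDF $\rho_0^g$. Let $\mathbf{y}\in\mathbb{R}^{N_y}$ be given data, and let $\mathbf{u}\mapsto\rho^g_{y|u}(\mathbf{y}|\mathbf{u})$ be the likelihood, assumed measurable in $\mathbf{u}$. Let $P^g_{u|y}$ (the push-forward posterior on $\mathbb{R}^{N_u}$) and $P^g_{z|y}$ (the latent space posterior on $\mathbb{R}^{N_z}$) be the probability distributions with PDFs $$\rho_{u|y}^g(\mathbf{u}|\mathbf{y})=\frac{\rho_{y|u}^g(\mathbf{y}|\mathbf{u})\,\rho_0^g(\mathbf{u})}{\int_{\mathbb{R}^{N_u}}\rho_{y|u}^g(\mathbf{y}|\mathbf{u})\,\rho_0^g(\mathbf{u})\,\mathrm{d}\mathbf{u}},\qquad \rho_{z|y}^g(\mathbf{z}|\mathbf{y})=\frac{\rho_{y|u}^g(\mathbf{y}|G_\theta(\mathbf{z}))\,\rho_z^g(\mathbf{z})}{\int_{\mathbb{R}^{N_z}}\rho_{y|u}^g(\mathbf{y}|G_\theta(\mathbf{z}))\,\rho_z^g(\mathbf{z})\,\mathrm{d}\mathbf{z}}.$$ Then the push-forward posterior and the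 latent space posterior are equal in the weak sense that, for all measurable functions $f$ on $\mathbb{R}^{N_u}$ (for which the expectations are defined), $$\mathbb{E}_{U\sim P_{u|y}^g}[f(U)]=\mathbb{E}_{Z\sim P_{z|y}^g}[f(G_\theta(Z))].$$
   Context: All probability distributions are assumed to have probability density functions (PDFs), i.e. $P_x(A)=\int_A\rho_x(x)\,\mathrm{d}x$; in particular the push-forward $P_u^g$ is assumed to have the PDF $\rho_0^g$. The push-forward distribution $G_{\theta\#}P_z^g$ is the distribution of $G_\theta(Z)$ when $Z\sim P_z^g$, i.e. $G_{\theta\#}P_z^g(A)=P_z^g(G_\theta^{-1}(A))$. The likelihood $\rho^g_{y|u}(\mathbf{y}|\mathbf{u})$ is the nonnegative conditional density of the data $\mathbf{y}$ given $\mathbf{u}$, viewed as a function of $\mathbf{u}$ for the fixed data $\mathbf{y}$; it has the form $\rho_\eta(\mathbf{y}-\mathbf{h}(\mathbf{u}))$ for an observation operator $\mathbf{h}:\mathbb{R}^{N_u}\to\mathbb{R}^{N_y}$ and a noise density $\rho_\eta$. The normalizing constants (evidences) in the posterior PDFs are understood to be positive and finite, so that the posteriors are well-defined probability distributions. *)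

(* Defs.v *)
(* MathComp-Analysis, with R^n represented by 'rV[R]_n. *)
From HB Require Import structures.
From mathcomp Require Import all_boot all_order all_algebra.
From mathcomp Require Import all_classical all_reals all_analysis.
From mathcomp Require Import measurable_realfun.

Set Implicit Arguments.
Unset Strict Implicit.
Unset Printing Implicit Defensive.

Import Order.TTheory GRing.Theory Num.Theory.
Import numFieldNormedType.Exports.

Local Open Scope classical_set_scope.
Local Open Scope ring_scope.

Definition rV_display : measure_display.
Proof. exact: default_measure_display. Qed.

Section borel_rV.
Variables (R : realType) (n : nat).

(* The matrix topology is the product topology, i.e. the Euclidean one. *)
Definition borel_rV : set (set 'rV[R]_n) := <<s @open 'rV[R]_n >>.

Let borel_rV0 : borel_rV set0.
Proof. exact: sigma_algebra0. Qed.

Let borel_rVC (A : set 'rV[R]_n) : borel_rV A -> borel_rV (~` A).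
Proof. exact: sigma_algebraC. Qed.

Let borel_rV_bigcup (F : (set 'rV[R]_n)^nat) :
  (forall i, borel_rV (F i)) -> borel_rV (\bigcup_i F i).
Proof. exact: sigma_algebra_bigcup. Qed.

HB.instance Definition _ := @isMeasurable.Build rV_display 'rV[R]_n
  borel_rV borel_rV0 borel_rVC borel_rV_bigcup.

End borel_rV.

Section borel_rV_theory.
Context {R : realType} {n : nat}.

Lemma open_measurable_rV (U : set 'rV[R]_n) : open U -> measurable U.
Proof. exact: sub_sigma_algebra. Qed.

Lemma measurable_coord (j : 'I_n) :
  measurable_fun setT (fun v : 'rV[R]_n => v 0 j).
Proof.
apply: (measurability _ (RGenOInfty.measurableE R)) => _ [_ [x ->] <-].
rewrite setTI; apply: open_measurable_rV.
apply: open_comp; last exact: interval_open.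
by move=> v _; exact: coord_continuous.
Qed.

Lemma measurable_fun_rV d (T : measurableType d) (f : T -> 'rV[R]_n) :
  (forall j, measurable_fun setT (fun t => f t 0 j)) -> measurable_fun setT f.
Proof.
move=> mf; apply: (measurability (@open 'rV[R]_n)) => // _ [U oU <-].
rewrite setTI.
pose B (p : 'rV[rat]_n * nat) : set 'rV[R]_n :=
  [set v | forall j, ball (ratr (p.1 0 j) : R) p.2.+1%:R^-1 (v 0 j)].
have -> : f @^-1` U = \bigcup_(p in [set p | B p `<=` U]) f @^-1` B p.
  apply/seteqP; split => [t Uft|t [p pU Bp]]; last exact: pU.
  have /nbhs_ballP[e /= e0 eU] : nbhs (f t) U by exact: open_nbhs_nbhs.
  have [k ke] : exists k : nat, k.+1%:R^-1 < e / 2.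
    have [k _ ke] := near_infty_natSinv_lt (PosNum (divr_gt0 e0 (ltr0n _ 2))).
    by exists k; exact: (ke k (leqnn k)).
  have k0 : 0 < k.+1%:R^-1 :> R by rewrite invr_gt0.
  have q j : exists q : rat, ball (ratr q : R) k.+1%:R^-1 (f t 0 j).
    have [r [ftq [q _ qr]]] := @dense_rat R (ball (f t 0 j) k.+1%:R^-1)
      (ex_intro _ _ (ballxx (f t 0 j) k0)) (ball_open _ _).
    by exists q; rewrite qr; exact: ball_sym.
  exists (\row_j sval (cid (q j)), k).
    move=> v Bv; apply: eU; split => // i j; rewrite ord1.
    have := Bv j; rewrite /= mxE; case: cid => /= r ftr vr.
    apply: (@le_ball _ _ _ (k.+1%:R^-1 + k.+1%:R^-1)).
      by rewrite [leRHS]splitr lerD// ltW.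
    by apply: ball_triangle vr; exact: ball_sym.
  by move=> j; rewrite /= mxE; case: cid.
rewrite bigcup_mkcond; apply: countable_bigcupT_measurable => // p.
case: ifPn => // _.
rewrite (_ : f @^-1` B p = \bigcap_(j in [set: 'I_n])
    (fun t => f t 0 j) @^-1` ball (ratr (p.1 0 j) : R) p.2.+1%:R^-1); last first.
  by apply/seteqP; split => [t Bt j _|t Bt j]; [exact: Bt|exact: (Bt j)].
apply: fin_bigcap_measurable => // j _.
by rewrite -[X in measurable X]setTI; apply: mf => //; exact: measurable_ball.
Qed.

End borel_rV_theory.

Section lebesgue_rV.
Variable R : realType.

Definition rV_cons n (p : R * 'rV[R]_n) : 'rV[R]_n.+1 := row_mx p.1%:M p.2.

Definition rV_uncons n (v : 'rV[R]_n.+1) : R * 'rV[R]_n :=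
  (v 0 ord0, @rsubmx _ 1 1 n v).

Lemma rV_cons0 n (p : R * 'rV[R]_n) : rV_cons p 0 ord0 = p.1.
Proof.
rewrite /rV_cons (_ : ord0 = lshift n (0 : 'I_1)); last exact: val_inj.
by rewrite (row_mxEl p.1%:M) mxE.
Qed.

Lemma rV_consS n (p : R * 'rV[R]_n) (j : 'I_n) :
  rV_cons p 0 (rshift 1 j) = p.2 0 j.
Proof. by rewrite /rV_cons (row_mxEr p.1%:M). Qed.

Lemma rV_consK n : cancel (@rV_cons n) (@rV_uncons n).
Proof.
by move=> [x v]; rewrite /rV_uncons rV_cons0 /rV_cons row_mxKr.
Qed.

Lemma measurable_rV_cons n : measurable_fun setT (@rV_cons n).
Proof.
apply: measurable_fun_rV => j; case: (split_ordP (j : 'I_(1 + n))) => k ->.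
- rewrite (_ : (fun _ => _) = fst); first exact: measurable_fst.
  rewrite ord1; apply/funext => p.
  by rewrite (_ : lshift n 0 = ord0) ?rV_cons0//; exact: val_inj.
- rewrite (_ : (fun _ => _) = (fun v : 'rV[R]_n => v 0 k) \o snd).
    by apply: measurableT_comp; [exact: measurable_coord|exact: measurable_snd].
  by apply/funext => p; rewrite rV_consS.
Qed.

Lemma measurable_rV_uncons n : measurable_fun setT (@rV_uncons n).
Proof.
apply: measurable_fun_pair; first exact: measurable_coord.
apply: measurable_fun_rV => j.
rewrite (_ : (fun _ => _) = fun v : 'rV[R]_n.+1 => v 0 (rshift 1 j)).
  exact: measurable_coord.
by apply/funext => v; rewrite mxE.
Qed.

Section lebesgue_rV_step.
Variables (n : nat) (mu : {sigma_finite_measure set 'rV[R]_n -> \bar R}).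

Definition rV_prod : set 'rV[R]_n.+1 -> \bar R :=
  pushforward (@lebesgue_measure R \x mu)%E (@rV_cons n).

Let preimage_rV_cons (A : set 'rV[R]_n.+1) :
  measurable A -> measurable (@rV_cons n @^-1` A).
Proof.
by move=> mA; rewrite -[X in measurable X]setTI; exact: measurable_rV_cons.
Qed.

Let rV_prod0 : rV_prod set0 = 0%E.
Proof. by rewrite /rV_prod /pushforward preimage_set0 measure0. Qed.

Let rV_prod_ge0 A : (0 <= rV_prod A)%E.
Proof. by apply: integral_ge0 => x _; exact: measure_ge0. Qed.

Let rV_prod_sigma_additive : semi_sigma_additive rV_prod.
Proof.
move=> F mF tF mUF; rewrite /rV_prod /pushforward preimage_bigcup.
apply: measure_semi_sigma_additive => [i||].
- exact: preimage_rV_cons.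
- apply/trivIsetP => i j _ _ ij; rewrite -preimage_setI.
  by move/trivIsetP : tF => -> //; rewrite preimage_set0.
- by rewrite -preimage_bigcup; exact: preimage_rV_cons.
Qed.

HB.instance Definition _ := isMeasure.Build _ _ _ rV_prod
  rV_prod0 rV_prod_ge0 rV_prod_sigma_additive.

Let rV_prod_sigma_finite : sigma_finite setT rV_prod.
Proof.
have /sigma_finiteP[F [TF ndF Foo]] := sigma_finiteT (@lebesgue_measure R).
have /sigma_finiteP[G [TG ndG Goo]] := sigma_finiteT mu.
exists (fun k => @rV_uncons n @^-1` (F k `*` G k)).
  apply/seteqP; split => // v _; rewrite -preimage_bigcup /=.
  have [i _ Fi] : (\bigcup_i F i) (v 0 ord0) by rewrite -TF.
  have [j _ Gj] : (\bigcup_j G j) (@rsubmx _ 1 1 n v) by rewrite -TG.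
  exists (maxn i j) => //; split.
    by move: Fi; exact/subsetPset/ndF/leq_maxl.
  by move: Gj; exact/subsetPset/ndG/leq_maxr.
move=> k; have [mF Fk] := Foo k; have [mG Gk] := Goo k; split.
  rewrite -[X in measurable X]setTI; apply: measurable_rV_uncons => //.
  exact: measurableX.
rewrite /rV_prod /pushforward -comp_preimage.
rewrite (_ : rV_uncons (n:=n) \o _ = id); last first.
  by rewrite funeqE; exact: rV_consK.
by rewrite preimage_id product_measure1E// lte_mul_pinfty// ge0_fin_numE.
Qed.

HB.instance Definition _ :=
  Measure_isSigmaFinite.Build _ _ _ rV_prod rV_prod_sigma_finite.

End lebesgue_rV_step.

(* Lebesgue measure on R^n, as the n-fold product of that of R; for n = 0 it is
   the unit mass of the one-point space. *)
Fixpoint lebesgue_rV n : {sigma_finite_measure set 'rV[R]_n -> \bar R} :=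
  match n with
  | 0 => \d_(0 : 'rV[R]_0)
  | n'.+1 => rV_prod (lebesgue_rV n')
  end.

Lemma lebesgue_rV_box n (a b : 'rV[R]_n) : (forall j, a 0 j <= b 0 j) ->
  lebesgue_rV n [set v : 'rV[R]_n | forall j, v 0 j \in `[a 0 j, b 0 j]] =
  (\prod_j (b 0 j - a 0 j))%:E.
Proof.
elim: n a b => [|n IH] a b ab.
  by rewrite big_ord0 /= diracE mem_set//= => -[].
have mI (c d : 'rV[R]_n) :
    measurable [set v : 'rV[R]_n | forall j, v 0 j \in `[c 0 j, d 0 j]].
  rewrite (_ : [set _ | _] = \bigcap_(j in [set: 'I_n])
      (fun v : 'rV[R]_n => v 0 j) @^-1` `[c 0 j, d 0 j]%classic); last first.
    by apply/seteqP; split => [v vcd j _|v vcd j]; [exact: vcd|exact: (vcd j)].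
  apply: fin_bigcap_measurable => // j _.
  by rewrite -[X in measurable X]setTI; exact: measurable_coord.
pose tl (c : 'rV[R]_n.+1) := @rsubmx _ 1 1 n c.
have -> : lebesgue_rV n.+1
      [set v : 'rV[R]_n.+1 | forall j, v 0 j \in `[a 0 j, b 0 j]] =
    (@lebesgue_measure R \x lebesgue_rV n)%E (`[a 0 ord0, b 0 ord0]%classic
    `*` [set v : 'rV[R]_n | forall j, v 0 j \in `[tl a 0 j, tl b 0 j]]).
  transitivity ((@lebesgue_measure R \x lebesgue_rV n)%E (@rV_cons n @^-1`
      [set v : 'rV[R]_n.+1 | forall j, v 0 j \in `[a 0 j, b 0 j]])); first by [].
  congr ((@lebesgue_measure R \x lebesgue_rV n)%E _).
  apply/seteqP; split => [[x v] /= h|[x v] /= [hx hv] j].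
    split => [|j].
      by have := h ord0; rewrite rV_cons0.
    by have := h (rshift 1 j); rewrite rV_consS /tl !mxE.
  case: (split_ordP (j : 'I_(1 + n))) => k ->.
    by rewrite ord1 (_ : lshift n 0 = ord0) ?rV_cons0//; exact: val_inj.
  by have := hv k; rewrite rV_consS /tl !mxE.
rewrite product_measure1E//= IH; last by move=> j; rewrite !mxE; exact: ab.
rewrite lebesgue_measure_itv/= lte_fin big_ord_recl.
have -> : \prod_j (tl b 0 j - tl a 0 j) =
    \prod_(i < n) (b 0 (lift ord0 i) - a 0 (lift ord0 i)).
  apply: eq_bigr => i _; rewrite !mxE.
  by rewrite (_ : rshift 1 i = lift ord0 i)//; exact: val_inj.
rewrite EFinM; congr (_ * _)%E; case: ltP => //.
have := ab ord0; rewrite le_eqVlt => /orP[/eqP -> |]; first by rewrite subrr.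
by move=> /lt_geF ->.
Qed.

End lebesgue_rV.
Arguments lebesgue_rV {R n}.

Section densities.
Context {R : realType} {n : nat}.
Local Open Scope ereal_scope.

Definition has_pdf (P : set 'rV[R]_n -> \bar R) (rho : 'rV[R]_n -> R) :=
  [/\ measurable_fun setT rho,
      forall x, (0 <= rho x)%R &
      forall A, measurable A -> P A = \int[lebesgue_rV]_(x in A) (rho x)%:E].

Definition evidence (L rho : 'rV[R]_n -> R) : \bar R :=
  \int[lebesgue_rV]_x (L x * rho x)%:E.

Definition posterior_pdf (L rho : 'rV[R]_n -> R) (x : 'rV[R]_n) : R :=
  (L x * rho x / fine (evidence L rho))%R.

End densities.

(* At least one of the integrals of the positive and negative parts of [f] is
   finite, so that the expectation is not of the form oo - oo. *)
Definition expectation_defined d (T : measurableType d) (R : realType)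
    (P : probability T R) (f : T -> R) : Prop :=
  ((\int[P]_x (EFin \o f)^\+ x < +oo) \/ (\int[P]_x (EFin \o f)^\- x < +oo))%E.

Definition likelihood (R : realType) (Nu Ny : nat) (rho_eta : 'rV[R]_Ny -> R)
    (h : 'rV[R]_Nu -> 'rV[R]_Ny) (y : 'rV[R]_Ny) (u : 'rV[R]_Nu) : R :=
  rho_eta (y - h u).

(* Main.v *)
Require Import Defs.
From HB Require Import structures.
From mathcomp Require Import all_boot all_order all_algebra.
From mathcomp Require Import all_classical all_reals all_analysis.
From mathcomp Require Import measurable_realfun.

Set Implicit Arguments.
Unset Strict Implicit.
Unset Printing Implicit Defensive.

Import Order.TTheory GRing.Theory Num.Theory.
Import numFieldNormedType.Exports.

Local Open Scope classical_set_scope.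
Local Open Scope ring_scope.
Local Open Scope ereal_scope.

(** The push-forward posterior is the image of the latent posterior under [G]:
    weighting the prior by the likelihood commutes with pushing it forward,
    because the weight [L \o G] on the latent space depends on [z] only through
    [G z].

    In the bookkeeping of densities, Lebesgue measure is used only to turn an
    integral against a probability into an integral against its density and back
    ([ge0_integral_pdf]). Applied to the posterior and to the prior, this gives
    Bayes' formula in a form free of densities ([ge0_integral_posterior]): a
    nonnegative [g] has posterior expectation [E[g L] / evidence], with both the
    numerator and the evidence taken under the prior. The change of variables
    [u = G z] then identifies numerators and evidences of the two problems
    ([evidence_pushforward], [ge0_integral_posterior_pushforward]). An arbitrary
    [f] follows by splitting into positive and negative parts. *)

(** The change of variables formula holds for the Radon-Nikodym derivative of
    [nu] with respect to [mu]; a density [rho] has the same integral over every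
    measurable set as this derivative, hence agrees with it almost everywhere. *)
Lemma ge0_integral_pdf d (T : measurableType d) (R : realType)
    (mu : {sigma_finite_measure set T -> \bar R})
    (nu : {finite_measure set T -> \bar R}) (rho : T -> R)
    (mrho : measurable_fun setT rho)
    (nuE : forall A, measurable A -> nu A = \int[mu]_(x in A) (rho x)%:E)
    (g : T -> \bar R) (mg : measurable_fun setT g) (g0 : forall x, 0 <= g x) :
  \int[nu]_x g x = \int[mu]_x (g x * (rho x)%:E).
Proof.
have mErho : measurable_fun setT (EFin \o rho) by exact/measurable_EFinP.
have numu : nu `<< mu.
  apply/null_content_dominatesP => A mA muA0; rewrite nuE//.
  by apply: null_set_integral => //; exact: measurable_funTS.
have intRN := Radon_Nikodym_SigmaFinite.f_integrable numu.
rewrite -(Radon_Nikodym_SigmaFinite.change_of_variables numu)//.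
apply: ae_eq_integral => //.
- by apply: emeasurable_funM => //; exact: (measurable_int mu).
- exact: emeasurable_funM.
- apply: ae_eqe_mul2l; apply: integral_ae_eq => // A _ mA.
  by rewrite -(Radon_Nikodym_SigmaFinite.f_integral numu)// nuE.
Qed.

Section bayes.
Context {R : realType} {n : nat}.
Variables (P : probability 'rV[R]_n R) (rho : 'rV[R]_n -> R).
Hypothesis P_pdf : has_pdf P rho.
Variable L : 'rV[R]_n -> R.
Hypotheses (mL : measurable_fun setT L) (L0 : forall x, (0 <= L x)%R).

Let mEL : measurable_fun setT (fun x => (L x)%:E).
Proof. exact/measurable_EFinP. Qed.

Lemma evidenceE : evidence L rho = \int[P]_x (L x)%:E.
Proof.
by have [mrho _ PE] := P_pdf; rewrite (ge0_integral_pdf mrho PE).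
Qed.

Lemma ge0_integral_posterior (Q : probability 'rV[R]_n R)
    (Q_pdf : has_pdf Q (posterior_pdf L rho))
    (g : 'rV[R]_n -> \bar R) (mg : measurable_fun setT g)
    (g0 : forall x, 0 <= g x) :
  \int[Q]_x g x =
  ((fine (evidence L rho))^-1)%:E * \int[P]_x (g x * (L x)%:E).
Proof.
have [mrho rho0 PE] := P_pdf; have [mpost _ QE] := Q_pdf.
have gL0 x : 0 <= g x * (L x)%:E by rewrite mule_ge0// lee_fin.
have mgL : measurable_fun setT (fun x => g x * (L x)%:E).
  exact: emeasurable_funM.
rewrite (ge0_integral_pdf mpost QE)// (ge0_integral_pdf mrho PE)//.
rewrite -ge0_integralZl_EFin//.
- apply: eq_integral => x _; rewrite /posterior_pdf EFinM EFinM.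
  by rewrite [RHS]muleC !muleA.
- by move=> x _; rewrite mule_ge0// lee_fin.
- by apply: emeasurable_funM => //; exact/measurable_EFinP.
- rewrite invr_ge0 fine_ge0// /evidence.
  by apply: integral_ge0 => x _; rewrite lee_fin mulr_ge0.
Qed.

End bayes.

Section pushforward_posterior.
Context {R : realType} {m n : nat}.
Variable G : 'rV[R]_m -> 'rV[R]_n.

Lemma continuous_measurable_fun_rV :
  continuous G -> measurable_fun setT G.
Proof.
move=> cG; apply: (measurability (@open 'rV[R]_n)) => // _ [U oU <-].
rewrite setTI; apply: open_measurable_rV.
by apply: open_comp => // x _; exact: cG.
Qed.

Hypothesis mG : measurable_fun setT G.
Variables (P : probability 'rV[R]_m R) (rho : 'rV[R]_m -> R).
Hypothesis P_pdf : has_pdf P rho.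
Variable rho0 : 'rV[R]_n -> R.
Hypothesis PG_pdf : has_pdf (pushforward P G) rho0.
Variable L : 'rV[R]_n -> R.
Hypotheses (mL : measurable_fun setT L) (L0 : forall x, (0 <= L x)%R).

(* Bundled with its measurability, [G] has an image measure that is recognized
   as a probability. *)
Let Gm : {mfun 'rV[R]_m >-> 'rV[R]_n} :=
  HB.pack G (isMeasurableFun.Build _ _ _ _ G mG).
Let PG : probability 'rV[R]_n R := distribution P Gm.

Let mLG : measurable_fun setT (L \o G).
Proof. exact: measurableT_comp. Qed.

Lemma evidence_pushforward : evidence L rho0 = evidence (L \o G) rho.
Proof.
have LG0 z : (0 <= (L \o G) z)%R by exact: L0.
rewrite (@evidenceE _ _ PG)// (@evidenceE _ _ P)//.
rewrite (ge0_integral_pushforward mG)//; first exact/measurable_EFinP.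
by move=> u _; rewrite lee_fin.
Qed.

Lemma ge0_integral_posterior_pushforward
    (Q : probability 'rV[R]_n R) (Q_pdf : has_pdf Q (posterior_pdf L rho0))
    (Q' : probability 'rV[R]_m R)
    (Q'_pdf : has_pdf Q' (posterior_pdf (L \o G) rho))
    (g : 'rV[R]_n -> \bar R) (mg : measurable_fun setT g)
    (g0 : forall x, 0 <= g x) :
  \int[Q]_x g x = \int[Q']_z g (G z).
Proof.
rewrite (ge0_integral_posterior (P := PG) PG_pdf mL L0 Q_pdf)//.
have LG0 z : (0 <= (L \o G) z)%R by exact: L0.
rewrite (ge0_integral_posterior P_pdf mLG LG0 Q'_pdf)//; last first.
  exact: measurableT_comp.
rewrite evidence_pushforward; congr (_ * _).
rewrite (ge0_integral_pushforward mG)//.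
  by apply: emeasurable_funM => //; exact/measurable_EFinP.
by move=> x _; rewrite mule_ge0// lee_fin.
Qed.

End pushforward_posterior.

Theorem theorem1 (R : realType) (Nz Nu Ny : nat)
  (G : 'rV[R]_Nz -> 'rV[R]_Nu) (G_continuous : continuous G)
  (Pz : probability 'rV[R]_Nz R) (rho_z : 'rV[R]_Nz -> R)
  (Pz_pdf : has_pdf Pz rho_z)
  (rho0 : 'rV[R]_Nu -> R)
  (Pu_pdf : has_pdf (pushforward Pz G) rho0)
  (P_eta : probability 'rV[R]_Ny R) (rho_eta : 'rV[R]_Ny -> R)
  (P_eta_pdf : has_pdf P_eta rho_eta)
  (h : 'rV[R]_Nu -> 'rV[R]_Ny) (y : 'rV[R]_Ny)
  (L_measurable : measurable_fun setT (likelihood rho_eta h y))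
  (evidence_u : 0 < evidence (likelihood rho_eta h y) rho0 < +oo)
  (evidence_z : 0 < evidence (likelihood rho_eta h y \o G) rho_z < +oo)
  (Pu_post : probability 'rV[R]_Nu R)
  (Pu_post_pdf : has_pdf Pu_post (posterior_pdf (likelihood rho_eta h y) rho0))
  (Pz_post : probability 'rV[R]_Nz R)
  (Pz_post_pdf :
    has_pdf Pz_post (posterior_pdf (likelihood rho_eta h y \o G) rho_z))
  (f : 'rV[R]_Nu -> R) (f_measurable : measurable_fun setT f)
  (Ef_defined : expectation_defined Pu_post f)
  (EfG_defined : expectation_defined Pz_post (f \o G)) :
  'E_Pu_post[f] = 'E_Pz_post[f \o G].
Proof.
have [_ rho_eta0 _] := P_eta_pdf.
have mG := continuous_measurable_fun_rV G_continuous.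
have L0 u : (0 <= likelihood rho_eta h y u)%R by exact: rho_eta0.
have postE := ge0_integral_posterior_pushforward mG Pz_pdf Pu_pdf L_measurable
  L0 Pu_post_pdf Pz_post_pdf.
have mEf : measurable_fun setT (EFin \o f) by exact/measurable_EFinP.
rewrite unlock integralE [RHS]integralE; congr (_ - _).
- rewrite (funepos_comp (EFin \o f) G).
  exact: postE (measurable_funepos mEf) (funepos_ge0 _).
- rewrite (funeneg_comp (EFin \o f) G).
  exact: postE (measurable_funeneg mEf) (funeneg_ge0 _).
Qed.
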